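(* Let $p=2$, $\mathbf X=(X_1,X_2)$, and assume that $P_X\ll\nu$, where $\nu=\nu_1\otimes\nu_2$ is absolutely continuous with respect to Lebesgue measure. Let $C$ be the copula of $\mathbf X$ and $c$ its density. For $0<M<1$, the following three conditions are equivalent: (1) $p_X\ge M\, p_{X_1}p_{X_2}$ $\nu$-a.e.; (2) $c(u,v)\ge M$ for all $(u,v)\in[0,1]^2$; (3) $C(u,v)=Muv+(1-M)\tilde C(u,v)$ for all $(u,v)\in[0,1]^2$, for some copula $\tilde C$.
   Context: $\mathbf X=(X_1,X_2)$ is a random vector in $\mathbb R^2$ with law $P_X$; $\nu$ is a $\sigma$-finite measure on $\mathbb R^2$, $p_X=dP_X/d\nu$, and $p_{X_i}$ is the marginal density of $X_i$ with respect to $\nu_i$. $F$ is the joint distribution function of $\mathbf X$ and $F_1,F_2$ are the marginal distribution functions. A (bivariate) copula is a distribution function on $[0,1]^2$ with uniform marginals. The copula $C$ of $\mathbf X$ is the unique copula (the marginals being absolutely continuous) with $F(x_1,x_2)=C(F_1(x_1),F_2(x_2))$. Its density is $$c(u,v)=\frac{\partial^2 C}{\partial u\,\partial v}(u,v),\qquad (u,v)\in[0,1]^2,$$ and $p_X(x_1,x_2)=c(F_1(x_1),F_2(x_2))p_{X_1}(x_1)p_{X_2}(x_2)$. Since this mixed derivative is in general only defined almost everywhere, condition (2) is understood at the points where it exists. *)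

(* Defs.v *)
From HB Require Import structures.
From mathcomp Require Export all_boot all_order all_algebra.
From mathcomp Require Export all_classical all_reals all_analysis.
Export Order.TTheory GRing.Theory Num.Theory.
Export numFieldNormedType.Exports.

Set Implicit Arguments.
Unset Strict Implicit.
Unset Printing Implicit Defensive.

Local Open Scope classical_set_scope.
Local Open Scope ring_scope.

Section random_vector.
Context d (T : measurableType d) (R : realType) (P : probability T R).
Variables X1 X2 : {RV P >-> R}.

Definition pair_RV (t : T) : R * R := (X1 t, X2 t).

Let measurable_pair_RV : measurable_fun setT pair_RV.
Proof. by apply: measurable_fun_pair; exact: measurable_funP. Qed.

HB.instance Definition _ := isMeasurableFun.Build _ _ _ _ pair_RV
  measurable_pair_RV.

Definition joint_cdf (x1 x2 : R) : \bar R :=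
  distribution P pair_RV (`]-oo, x1] `*` `]-oo, x2]).

End random_vector.

(* Radon-Nikodym density of a law; the library's operator is stated for
   charges. *)
Definition density d (T : measurableType d) (R : realType)
    (mu : probability T R) (nu : {sigma_finite_measure set T -> \bar R}) :
    T -> \bar R :=
  Radon_Nikodym (charge_of_finite_measure mu) nu.

(* A copula is only constrained on [0,1]^2; its values elsewhere are
   irrelevant. *)
Definition is_copula (R : realType) (C : R -> R -> R) : Prop :=
  exists mu : probability (R * R)%type R,
    [/\ mu (`[0, 1] `*` `[0, 1]) = 1%E,
        forall A : set R, measurable A ->
          mu (A `*` setT) = uniform_prob (@ltr01 R) A,
        forall A : set R, measurable A ->
          mu (setT `*` A) = uniform_prob (@ltr01 R) A &
        forall u v : R, u \in `[0, 1] -> v \in `[0, 1] ->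
          (C u v)%:E = mu (`]-oo, u] `*` `]-oo, v])].

(* C is the copula of (X1, X2); it is unique on [0,1]^2 when both cdfs are
   continuous. *)
Definition is_copula_of d (T : measurableType d) (R : realType)
    (P : probability T R) (X1 X2 : {RV P >-> R}) (C : R -> R -> R) : Prop :=
  is_copula C /\
  forall x1 x2 : R,
    joint_cdf X1 X2 x1 x2 = (C (fine (cdf X1 x1)) (fine (cdf X2 x2)))%:E.

(* Derivative of f : [0,1] -> R at x in [0,1]: two-sided in the interior,
   one-sided at the end points. *)
Definition is_deriv01 (R : realType) (f : R -> R) (x l : R) : Prop :=
  (f y - f x) / (y - x) @[y --> within `[0, 1] x^'] --> l.

(* The mixed derivative of C at (u, v) exists and equals c: the inner partial
   derivative g must exist on a neighbourhood of u in [0,1]. *)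
Definition is_copula_density_at (R : realType) (C : R -> R -> R)
    (u v c : R) : Prop :=
  exists g : R -> R,
    (\forall s \near within `[0, 1] (nbhs u), is_deriv01 (C s) v (g s)) /\
    is_deriv01 g u c.

(* Main.v *)
From HB Require Import structures.
Require Import Defs.
From mathcomp Require Import measurable_realfun lra.

(** The three conditions are compared with a single inequality between
    measures.  Let mu be the probability on the plane whose distribution
    function is the copula C, and let U be the uniform law on [0, 1].  The pivot
    is

      (I)  M * (U x U) B <= mu B  for every Borel set B.

    _(1) and (I)._  Condition (1) says that M times the product of the
    marginals is below the law of (X1, X2), because the product of the marginal
    densities is a density of that product (integral_product_density,
    le_density_product).  The quantile
    functions (Q1, Q2) send mu to the law of (X1, X2) and U x U to the product
    of the marginals, and, the marginals having no atoms, the marginal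
    distribution functions (F1, F2) undo (Q1, Q2) on the open unit square, which
    carries all the mass.  Inequalities between measures therefore travel in
    both directions (le_copula_product).  The same transport shows that mu is
    absolutely continuous (copula_dominates), since the law of (X1, X2) is
    dominated by the product of its marginals (dominates_product).

    _(I) implies (3) implies (2)._  The normalized difference of mu and
    M * (U x U) is a probability with uniform marginals, and its distribution
    function is the copula of (3) (mixture_copula).  Conversely, the rectangle
    increments of the copula in (3) are nonnegative, so those of C are at least
    M times the areas, and this passes to the limit in the two successive
    difference quotients (copula_density_lower_bound).

    _(2) implies (I)._  Here the mixed derivative of C has to exist almost
    everywhere and to be the density c of mu.  The derivative is an iterated
    one: at (u, v) the partial derivative in v must exist on a whole neighbourhood
    of u, whereas differentiating the integral gives, for each s, an exceptional
    null set of v depending on s.  Taking countably many s makes this null set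
    uniform over the rational s; the other s follow by squeezing, because the
    difference quotients of C(s, .) at v are nondecreasing in s and their limit
    at rational s is the restriction of a continuous function
    (quotient_cvg_monotone_family).  A second differentiation, in s, yields c
    (ae_mixed_derivative).  Thus (2) bounds c from below almost everywhere, and
    integrating gives (I) (copula_density_measure_ge). *)

Set Implicit Arguments.
Unset Strict Implicit.
Unset Printing Implicit Defensive.
Local Open Scope classical_set_scope.
Local Open Scope ring_scope.

(** * Measures determined by rays and quadrants *)

Lemma itvNycI (R : realType) (x y : R) :
  `]-oo, x] `&` `]-oo, y] = `]-oo, Num.min x y]%classic.
Proof.
by apply/seteqP; split => z /=; rewrite !in_itv/= le_min;
  [move=> [-> ->]|move/andP].
Qed.

Lemma eq_finite_measure_ray (R : realType)
    (m1 m2 : {finite_measure set R -> \bar R}) :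
  (forall x : R, m1 `]-oo, x]%classic = m2 `]-oo, x]%classic) ->
  forall A, measurable A -> m1 A = m2 A.
Proof.
move=> m12 A mA.
pose G : set (set R) := range (fun x => `]-oo, x]%classic).
apply: (measure_unique G (fun n => `]-oo, n%:R]%classic)) => //.
- rewrite (_ : measurable = <<s @RGenOInfty.G R >>); last first.
    exact: RGenOInfty.measurableE.
  rewrite eqEsubset; split; apply: smallest_sub.
  + exact: smallest_sigma_algebra.
  + move=> _ [x ->]; rewrite -setCitvl.
    by apply: sigma_algebraC; apply: sub_sigma_algebra; exists x.
  + exact: smallest_sigma_algebra.
  + move=> _ [x _ <-]; rewrite -setCitvr.
    by apply: sigma_algebraC; apply: sub_sigma_algebra; exists x.
- move=> _ _ [x _ <-] [y _ <-]; exists (Num.min x y) => //.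
  by rewrite itvNycI.
- by move=> n; exists n%:R.
- rewrite -subTset => x _ /=; exists (Num.bound `|x|) => //=.
  rewrite in_itv/= ltW// (le_lt_trans (ler_norm _))//.
  by rewrite archi_boundP ?normr_ge0.
- by move=> _ [x _ <-]; exact: m12.
- by move=> n; rewrite ltey_eq fin_num_measure.
Qed.

Section quadrants.
Context {R : realType}.

Definition quadrants : set (set (R * R)%type) :=
  [set `]-oo, p.1]%classic `*` `]-oo, p.2]%classic | p in setT].

Let measurable_fun_of_rays (f : g_sigma_algebraType quadrants -> R) :
  (forall x, <<s quadrants >> (f @^-1` `]-oo, x])) -> measurable_fun setT f.
Proof.
move=> fray; apply: (measurability _ (RGenOInfty.measurableE R)).
move=> _ [_ [x ->] <-].
by rewrite setTI -setCitvl preimage_setC; apply: measurableC; exact: fray.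
Qed.

(** Half-planes are countable unions of quadrants, and they generate the product
    sigma-algebra. *)
Lemma measurable_quadrants : measurable = <<s quadrants >>.
Proof.
rewrite eqEsubset; split; apply: smallest_sub.
- exact: smallest_sigma_algebra.
- have halfplane (f g : R * R -> R) : (forall x n, <<s quadrants >>
      (f @^-1` `]-oo, x] `&` g @^-1` `]-oo, n])) ->
      preimage_set_system setT f measurable `<=` <<s quadrants >>.
    move=> fg; pose f' : g_sigma_algebraType quadrants -> R := f.
    have mf' : measurable_fun setT f'.
      apply: measurable_fun_of_rays => x.
      rewrite (_ : _ @^-1` _ = \bigcup_n
        (f @^-1` `]-oo, x] `&` g @^-1` `]-oo, n%:R])); last first.
        apply/seteqP; split=> [p fp|p [n _ []//]].
        exists (Num.bound `|g p|) => //; split => //=; rewrite in_itv/=.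
        by rewrite ltW// (le_lt_trans (ler_norm _))// archi_boundP ?normr_ge0.
      by apply: sigma_algebra_bigcup => n; exact: fg.
    by move=> _ [A mA <-]; exact: mf'.
  rewrite subUset; split.
  + apply: (halfplane _ snd) => x n; apply: sub_sigma_algebra.
    by exists (x, n).
  + apply: (halfplane _ fst) => x n; apply: sub_sigma_algebra.
    by exists (n, x) => //; rewrite setIC.
- exact: sigma_algebra_measurable.
- by move=> _ [p _ <-]; exact: measurableX.
Qed.

(** Quadrants are stable under intersection and generate the Borel sets of the
    plane. *)
Lemma eq_finite_measure_quadrant
    (m1 m2 : {finite_measure set (R * R)%type -> \bar R}) :
  (forall x y, m1 (`]-oo, x] `*` `]-oo, y]) = m2 (`]-oo, x] `*` `]-oo, y])) ->
  forall A, measurable A -> m1 A = m2 A.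
Proof.
move=> m12 A mA.
apply: (measure_unique quadrants
  (fun n => `]-oo, n%:R] `*` `]-oo, n%:R])) => //.
- exact: measurable_quadrants.
- move=> _ _ [p _ <-] [q _ <-].
  exists (Num.min p.1 q.1, Num.min p.2 q.2) => //=; rewrite -setXI.
  by rewrite !itvNycI.
- by move=> n; exists (n%:R, n%:R).
- rewrite -subTset => x _ /=; exists (Num.bound `|Num.max x.1 x.2|) => //=.
  by split; rewrite /= in_itv/= ltW// (@le_lt_trans _ _ (Num.max x.1 x.2))
    ?le_max ?lexx ?orbT// (le_lt_trans (ler_norm _))// archi_boundP ?normr_ge0.
- by move=> _ [p _ <-]; exact: m12.
- by move=> n; rewrite ltey_eq fin_num_measure//; exact: measurableX.
Qed.

End quadrants.

Lemma measure_setI_full d (T : measurableType d) (R : realType)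
    (m : {measure set T -> \bar R}) (A D : set T) :
  measurable A -> measurable D -> m (~` D) = 0%E -> m A = m (A `&` D).
Proof.
move=> mA mD D0; rewrite -[A in LHS](setUIDK A D) measureU0//.
- exact: measurableI.
- exact: measurableD.
- apply: (@subset_measure0 _ _ _ m _ (~` D)) => //.
  + exact: measurableD.
  + exact: measurableC.
Qed.

(** * Uniform law and quantile functions *)

Section unif01.
Context {R : realType}.
Local Notation leb := (@lebesgue_measure R).

(** The set function uniform_prob regarded as a probability on R rather than on
    measurableTypeR R; both carry the same measurable sets, but under different
    displays. *)
Definition unif01 : set R -> \bar R := uniform_prob (@ltr01 R).

HB.instance Definition _ := isMeasure.Build _ R _ unif01
  (measure0 (uniform_prob (@ltr01 R)))
  (measure_ge0 (uniform_prob (@ltr01 R)))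
  (@measure_semi_sigma_additive _ _ _ (uniform_prob (@ltr01 R))).

HB.instance Definition _ := Measure_isProbability.Build _ R _ unif01
  (@probability_setT _ _ _ (uniform_prob (@ltr01 R))).

Local Notation U := unif01.

Lemma unif01E (A : set R) : measurable A -> U A = leb (A `&` `[0, 1]).
Proof.
move=> mA; rewrite /unif01 -[A in LHS]setIT -integral_indic//.
rewrite integral_uniform//=; last first.
  exact/measurable_EFinP/measurable_indic.
by rewrite subr0 invr1 mul1e integral_indic//.
Qed.

Lemma unif01_ray (x : R) : 0 <= x <= 1 -> U `]-oo, x]%classic = x%:E.
Proof.
move=> /andP[x0 x1]; rewrite unif01E//.
rewrite (_ : _ `&` _ = `[0, x]%classic).
  by rewrite lebesgue_measure_itv/= lte_fin; case: ltgtP x0 => // [_|<-];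
    rewrite ?sube0.
apply/seteqP; split => y /=; rewrite !in_itv/=.
  by move=> [-> /andP[->]].
by move=> /andP[-> yx]; rewrite yx (le_trans yx x1).
Qed.

Lemma unif01_oo : U `]0, 1[%classic = 1%E.
Proof.
rewrite unif01E// setIidl; last first.
  by move=> x /=; rewrite !in_itv/= => /andP[/ltW -> /ltW ->].
by rewrite lebesgue_measure_itv/= lte_fin ltr01 sube0.
Qed.

Lemma unif01_ooC : U (~` `]0, 1[%classic) = 0%E.
Proof. by rewrite probability_setC// [X in (_ - X)%E]unif01_oo subee. Qed.

Lemma unif01_setIoo (A : set R) :
  measurable A -> U A = U (A `&` `]0, 1[%classic).
Proof. by move=> mA; apply: measure_setI_full => //; exact: unif01_ooC. Qed.

End unif01.

Section quantile.
Context d (T : measurableType d) (R : realType) (P : probability T R).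
Variable X : {RV P >-> R}.
Local Notation U := (@unif01 R).

(** For u outside ]0, 1[ the set below may be empty or unbounded; such u form a
    null set for the uniform law, so any value does. *)
Definition quantile (u : R) : R :=
  if 0 < u < 1 then inf [set x | (u%:E <= cdf X x)%E] else 0.

(** Galois connection between the quantile function and the distribution
    function: right continuity puts the infimum inside the set it bounds. *)
Lemma quantile_le (u x : R) : 0 < u < 1 ->
  (quantile u <= x) = (u%:E <= cdf X x)%E.
Proof.
move=> u01; rewrite /quantile u01; move: u01 => /andP[u0 u1].
set S := [set x | _].
have fcdf r : (fine (cdf X r))%:E = cdf X r by rewrite fineK ?fin_num_measure.
have Slb : has_lbound S.
  have /cvgr_lt/(_ _ u0)[N [_ HN]] : (fine \o cdf X) @ -oo --> (0 : R).
    exact/fine_cvg/cvg_cdfNy0.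
  exists N => y; rewrite /S/= -fcdf lee_fin !leNgt; apply: contra.
  exact: HN.
have S0 : S !=set0.
  have /cvgr_gt/(_ _ u1)[N [_ HN]] : (fine \o cdf X) @ +oo --> (1 : R).
    exact/fine_cvg/cvg_cdfy1.
  exists (N + 1); rewrite /S/= -fcdf lee_fin ltW//.
  by apply: HN; rewrite ltrDl.
apply/idP/idP => [Sx|ux]; last by apply: ge_inf.
have cr : fine (cdf X r) @[r --> x^'+] --> fine (cdf X x).
  by apply: fine_cvg; rewrite fcdf; exact: cdf_right_continuous.
rewrite -fcdf lee_fin; apply: (cvgr_to_ge cr).
near=> r.
have : inf S < r by rewrite (le_lt_trans Sx)//; near: r; exact: nbhs_right_gt.
move=> /(inf_lt S0)[y Sy yr].
rewrite -lee_fin fcdf (le_trans Sy)//.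
by apply: cdf_nondecreasing; exact: ltW.
Unshelve. all: by end_near. Qed.

Lemma measurable_quantile : measurable_fun setT quantile.
Proof.
rewrite -(setUv `]0, 1[%classic); apply/measurable_funU => //.
  exact: measurableC.
split.
  apply: (measurability _ (@RGenOInfty.measurableE R)) => _ [_ [x ->] <-].
  rewrite (_ : _ `&` _ = `]0, 1[%classic `&`
      (`]fine (cdf X x), +oo[%classic : set R)); first exact: measurableI.
  have uE (u : R) : 0 < u < 1 -> (x < quantile u) = (fine (cdf X x) < u).
    move=> u01; rewrite !ltNge quantile_le//.
    by rewrite -[cdf X x]fineK ?fin_num_measure// lee_fin.
  by apply/seteqP; split => u /= [+ +]; rewrite !in_itv/= !andbT => u01;
    rewrite uE.
apply: (eq_measurable_fun (cst (0 : R))) => // u.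
by rewrite inE/= in_itv/= /quantile => /negP/negbTE ->.
Qed.

HB.instance Definition _ := isMeasurableFun.Build _ _ _ _ quantile
  measurable_quantile.

(** Inverse transform sampling. *)
Lemma distribution_quantile A : measurable A ->
  U (quantile @^-1` A) = distribution P X A.
Proof.
apply: (@eq_finite_measure_ray R (distribution U quantile) (distribution P X)).
move=> x; pose p := fine (cdf X x).
have pE : cdf X x = p%:E by rewrite fineK ?fin_num_measure.
have p01 : 0 <= p <= 1 by rewrite -!lee_fin -pE cdf_ge0 cdf_le1.
rewrite -[RHS]/(cdf X x) pE -(unif01_ray p01) -[LHS]/(U (quantile @^-1` _)).
rewrite unif01_setIoo; last exact: measurable_funPTI.
rewrite [RHS]unif01_setIoo//; congr (U _).
apply/seteqP; split => u /= [+ u01]; move: (u01); rewrite !in_itv/= => {}u01;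
  by rewrite quantile_le// pE lee_fin.
Qed.

(** The distribution function is below u on the left of the quantile of u, hence
    at most u there, because it does not jump. *)
Lemma cdf_quantile (u : R) : (forall x, distribution P X [set x] = 0%E) ->
  0 < u < 1 -> cdf X (quantile u) = u%:E.
Proof.
move=> noatom u01; set q := quantile u.
apply/eqP; rewrite eq_le -quantile_le// lexx andbT.
have -> : cdf X q = distribution P X `]-oo, q[%classic.
  rewrite /cdf (_ : `]-oo, q]%classic = `]-oo, q[ `|` [set q]); last first.
    by rewrite setUitv1.
  by rewrite measureU0//; exact: noatom.
pose F n : set R := `]-oo, q - n.+1%:R^-1]%classic.
have mF n : measurable (F n) by exact: measurable_itv.
have -> : `]-oo, q[%classic = \bigcup_n F n.
  apply/seteqP; split => [y|y [n _]]; rewrite /F /= !in_itv/=.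
    move=> /ltr_add_invr[n ynq]; exists n => //=.
    by rewrite in_itv/= lerBrDr ltW.
  by move=> /le_lt_trans; apply; rewrite ltrBlDr ltrDl invr_gt0.
have : distribution P X (F n) @[n --> \oo] --> distribution P X (\bigcup_n F n).
  apply: nondecreasing_cvg_mu => //; first exact: bigcupT_measurable.
  move=> m n mn; apply/subsetPset; apply: subset_itvl.
  by rewrite bnd_simp lerB// lef_pV2 ?posrE// ler_nat.
apply: cvge_le; apply: nearW => n.
rewrite leNgt; apply/negP => /ltW.
rewrite -[distribution P X (F n)]/(cdf X (q - n.+1%:R^-1)) -quantile_le//.
by rewrite leNgt ltrBlDr ltrDl invr_gt0 ltr0n.
Qed.

End quantile.

(** * Transport between a law and its copula *)

(** Open, because the quantile functions are only meaningful on ]0, 1[. *)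
Definition unit_square (R : realType) : set (R * R) :=
  `]0, 1[%classic `*` `]0, 1[%classic.
Arguments unit_square {R}.

Lemma measurable_unit_square (R : realType) : measurable (@unit_square R).
Proof. exact: measurableX. Qed.
#[global] Hint Resolve measurable_unit_square : core.

Definition uniform_marginals (R : realType)
    (mu : set (R * R)%type -> \bar R) : Prop :=
  (forall A : set R, measurable A -> mu (A `*` setT) = unif01 A) /\
  (forall A : set R, measurable A -> mu (setT `*` A) = unif01 A).

Lemma unif01X_marginals (R : realType) :
  uniform_marginals (@unif01 R \x @unif01 R)%E.
Proof.
split => A mA.
  transitivity (unif01 A * unif01 [set: R])%E; first exact: product_measure1E.
  by rewrite [unif01 setT]probability_setT mule1.
transitivity (unif01 [set: R] * unif01 A)%E; first exact: product_measure1E.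
by rewrite [unif01 setT]probability_setT mul1e.
Qed.

Lemma unit_squareC0 (R : realType) (mu : probability (R * R)%type R) :
  uniform_marginals mu -> mu (~` unit_square) = 0%E.
Proof.
move=> [m1 m2]; rewrite /unit_square.
have -> : ~` (`]0, 1[%classic `*` `]0, 1[%classic) =
    ((~` `]0, 1[%classic : set R) `*` [set: R]) `|`
    ([set: R] `*` (~` `]0, 1[%classic : set R)) :> set (R * R).
  apply/seteqP; split => -[x y]/=; rewrite !in_itv/=.
    by move=> /not_andP[]; [left|right].
  by move=> [[h _]|[_ h]] [].
have mC : measurable (~` `]0, 1[%classic : set R) by exact: measurableC.
rewrite measureU0; [|exact: measurableX|exact: measurableX|].
  exact: etrans (m1 _ mC) unif01_ooC.
exact: etrans (m2 _ mC) unif01_ooC.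
Qed.

Section copula_transport.
Context d (T : measurableType d) (R : realType) (P : probability T R).
Variables X1 X2 : {RV P >-> R}.
Local Notation PX := (distribution P (pair_RV X1 X2)).
Local Notation P1 := (distribution P X1).
Local Notation P2 := (distribution P X2).
Local Notation UU := (@unif01 R \x @unif01 R)%E.

Definition quantile2 (p : R * R) : R * R := (quantile X1 p.1, quantile X2 p.2).

Let measurable_quantile2 : measurable_fun setT quantile2.
Proof.
by apply: measurable_fun_pair => /=; apply: measurableT_comp => //;
  exact: measurable_quantile.
Qed.

HB.instance Definition _ := isMeasurableFun.Build _ _ _ _ quantile2
  measurable_quantile2.

Definition cdf2 (p : R * R) : R * R := (fine (cdf X1 p.1), fine (cdf X2 p.2)).

Lemma measurable_cdf2 : measurable_fun setT cdf2.
Proof.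
by apply: measurable_fun_pair => /=; apply: measurableT_comp => //;
  apply: measurableT_comp => //; exact: cdf_measurable.
Qed.

(** The two coordinates are transformed separately, so a product law stays a
    product law. *)
Lemma product_quantile2 A : measurable A ->
  UU (quantile2 @^-1` A) = (P1 \x P2)%E A.
Proof.
move=> mA; rewrite (@product_measure_unique _ _ _ _ _ P1 P2
  (distribution UU quantile2))// => B C mB mC.
transitivity (unif01 (quantile X1 @^-1` B) * unif01 (quantile X2 @^-1` C))%E.
  by apply: product_measure1E; exact: measurable_funPTI.
by congr (_ * _)%E; exact: distribution_quantile.
Qed.

Variable C : R -> R -> R.
Variable mu : probability (R * R)%type R.
Hypothesis mu_marg : uniform_marginals mu.
Hypothesis muC : forall u v : R, u \in `[0, 1] -> v \in `[0, 1] ->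
  (C u v)%:E = mu (`]-oo, u] `*` `]-oo, v]).
Hypothesis C_of : forall x1 x2 : R,
  joint_cdf X1 X2 x1 x2 = (C (fine (cdf X1 x1)) (fine (cdf X2 x2)))%:E.

(** By the Galois connection, the preimage of a quadrant with corner (x, y) is,
    inside the unit square, the quadrant with corner (F1 x, F2 y), whose mass is
    C (F1 x) (F2 y). *)
Lemma distribution_quantile2 A : measurable A ->
  mu (quantile2 @^-1` A) = PX A.
Proof.
apply: (@eq_finite_measure_quadrant R (distribution mu quantile2) PX) => x y.
rewrite -[RHS]/(joint_cdf X1 X2 x y) C_of muC; last 2 first.
- by rewrite in_itv/= -!lee_fin fineK ?fin_num_measure// cdf_ge0 cdf_le1.
- by rewrite in_itv/= -!lee_fin fineK ?fin_num_measure// cdf_ge0 cdf_le1.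
rewrite -[LHS]/(mu (quantile2 @^-1` (`]-oo, x]%classic `*` `]-oo, y]%classic))).
rewrite (measure_setI_full _ (@measurable_unit_square R)
  (unit_squareC0 mu_marg)).
  rewrite [RHS](measure_setI_full _ (@measurable_unit_square R)
    (unit_squareC0 mu_marg)); last exact: measurableX.
  congr (mu _); apply/seteqP; split => -[u v]/= [] [] + + []; rewrite !in_itv/=;
    move=> + + u01 v01; rewrite !quantile_le//;
    by rewrite -[cdf X1 x]fineK ?fin_num_measure// -[cdf X2 y]fineK
      ?fin_num_measure// !lee_fin.
by apply: measurable_funPTI; exact: measurableX.
Qed.

Hypothesis noatom1 : forall x, P1 [set x] = 0%E.
Hypothesis noatom2 : forall x, P2 [set x] = 0%E.

Lemma quantile2K (p : R * R) : unit_square p -> cdf2 (quantile2 p) = p.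
Proof.
by case: p => u v [/=]; rewrite !in_itv/= => u01 v01; rewrite /cdf2/=
  !cdf_quantile.
Qed.

(** The retraction of quantile2K holds on a set of full mass. *)
Lemma measure_quantile2K (m : probability (R * R)%type R) B :
  uniform_marginals m -> measurable B ->
  m B = m (quantile2 @^-1` (cdf2 @^-1` B)).
Proof.
move=> mm mB; have mFB : measurable (quantile2 @^-1` (cdf2 @^-1` B)).
  apply: measurable_funPTI.
  by rewrite -[X in measurable X]setTI; exact: measurable_cdf2.
rewrite (measure_setI_full _ (@measurable_unit_square R) (unit_squareC0 mm))//.
rewrite [RHS](measure_setI_full _ (@measurable_unit_square R)
  (unit_squareC0 mm))//.
congr (m _); apply/seteqP; split => p /= [+ sp]; rewrite quantile2K//.
Qed.

(** A null set of the square is pulled back by the distribution functions to a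
    null set of the product of the marginals. *)
Lemma copula_dominates : PX `<< (P1 \x P2)%E -> mu `<< UU.
Proof.
move=> /null_content_dominatesP dom; apply/null_content_dominatesP => A mA A0.
have mFA : measurable (cdf2 @^-1` A).
  by rewrite -[X in measurable X]setTI; exact: measurable_cdf2.
rewrite (measure_quantile2K mu_marg)// distribution_quantile2//.
apply: dom => //; rewrite -[RHS]A0.
apply: etrans (esym (product_quantile2 mFA)) _.
exact/esym/(measure_quantile2K (@unif01X_marginals R)).
Qed.

(** Images by the quantiles carry the second inequality to the first; preimages
    by the distribution functions carry it back. *)
Lemma le_copula_product (M : R) :
  (forall A, measurable A -> (M%:E * (P1 \x P2) A <= PX A)%E) <->
  (forall B, measurable B -> (M%:E * UU B <= mu B)%E).
Proof.
split => [le_P A mA|le_U A mA].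
  have mFA : measurable (cdf2 @^-1` A).
    by rewrite -[X in measurable X]setTI; exact: measurable_cdf2.
  rewrite (measure_quantile2K mu_marg)// distribution_quantile2//.
  rewrite [X in (_ * X)%E](_ : _ = (P1 \x P2)%E (cdf2 @^-1` A)).
    exact: le_P.
  rewrite -product_quantile2//.
  exact: (measure_quantile2K (@unif01X_marginals R)).
rewrite -distribution_quantile2// -product_quantile2//.
by apply: le_U; exact: measurable_funPTI.
Qed.

End copula_transport.

(** * Densities of a law and of the product of its marginals *)

Section integral_comparison.
Local Open Scope ereal_scope.

(** On the set where g < f both integrals coincide over every measurable subset,
    so that f = g almost everywhere there. *)
Lemma integral_le_ae d (T : measurableType d) (R : realType)
    (mu : {measure set T -> \bar R}) (f g : T -> \bar R) :
  mu.-integrable setT f -> mu.-integrable setT g ->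
  (forall A, measurable A -> \int[mu]_(x in A) f x <= \int[mu]_(x in A) g x) ->
  {ae mu, forall x, f x <= g x}.
Proof.
move=> intf intg fg.
have mf : measurable_fun setT f by exact: measurable_int intf.
have mg : measurable_fun setT g by exact: measurable_int intg.
pose D := [set x | g x < f x].
have mD : measurable D.
  by rewrite -[D]setTI; exact: emeasurable_fun_lt.
have : ae_eq mu D f g.
  apply: integral_ae_eq => //.
  - exact: integrableS intf.
  - exact: measurable_funTS.
  - move=> A AD mA; apply/eqP; rewrite eq_le fg//=.
    apply: le_integral => //.
    + exact: integrableS intg.
    + exact: integrableS intf.
    + by move=> x /[!inE] /AD /ltW.
apply: filterS => x fgx; rewrite leNgt; apply/negP => gf.
by move: (gf); rewrite fgx// ltxx.
Qed.

Lemma ae_le_integral d (T : measurableType d) (R : realType)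
    (mu : {measure set T -> \bar R}) (f g : T -> \bar R) :
  measurable_fun setT f -> measurable_fun setT g ->
  (forall x, 0 <= f x) -> (forall x, 0 <= g x) ->
  {ae mu, forall x, f x <= g x} ->
  forall A, measurable A -> \int[mu]_(x in A) f x <= \int[mu]_(x in A) g x.
Proof.
move=> mf mg f0 g0 fg A mA.
apply: ae_ge0_le_integral => //; [exact: measurable_funTS..|].
by apply: filterS fg => x + _.
Qed.

End integral_comparison.

Module RN := Radon_Nikodym_SigmaFinite.

Section product_density.
Local Open Scope ereal_scope.
Context d1 d2 (T1 : measurableType d1) (T2 : measurableType d2) (R : realType).
Variables (P1 : {finite_measure set T1 -> \bar R}).
Variables (P2 : {finite_measure set T2 -> \bar R}).
Variables (nu1 : {sigma_finite_measure set T1 -> \bar R}).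
Variables (nu2 : {sigma_finite_measure set T2 -> \bar R}).
Hypotheses (dom1 : P1 `<< nu1) (dom2 : P2 `<< nu2).

(** RN.f is a version of the Radon-Nikodym derivative that is nonnegative and
    finite everywhere; it agrees almost everywhere with density. *)
Definition product_density (p : T1 * T2) : \bar R :=
  RN.f P1 nu1 p.1 * RN.f P2 nu2 p.2.

Let mf1 : measurable_fun setT (RN.f P1 nu1).
Proof. exact: measurable_int (RN.f_integrable dom1). Qed.

Let mf2 : measurable_fun setT (RN.f P2 nu2).
Proof. exact: measurable_int (RN.f_integrable dom2). Qed.

Lemma measurable_product_density : measurable_fun setT product_density.
Proof. by apply: emeasurable_funM; apply: measurableT_comp. Qed.

Lemma product_density_ge0 p : 0 <= product_density p.
Proof. by rewrite mule_ge0// RN.f_ge0. Qed.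

(** Integrating the sections of A and changing variables in each coordinate
    reduces this to Tonelli. *)
Lemma integral_product_density A : measurable A ->
  \int[(nu1 \x nu2)]_(p in A) product_density p = (P1 \x P2) A.
Proof.
move=> mA; rewrite -[RHS]/(\int[P1]_x (P2 \o xsection A) x).
rewrite -(RN.change_of_variables dom1)//; last exact: measurable_fun_xsection.
rewrite integral_mkcond fubini_tonelli1/=; last 2 first.
- apply/(measurable_restrictT _ mA); apply: measurable_funTS.
  exact: measurable_product_density.
- by move=> p; rewrite patchE; case: ifPn => // _; exact: product_density_ge0.
apply: eq_integral => x _ /=; rewrite /fubini_F.
rewrite (RN.f_integral dom2); last exact: measurable_xsection.
rewrite muleC -ge0_integralZl//; last 4 first.
- exact: measurable_xsection.
- exact: measurable_funTS.
- by move=> y _; exact: RN.f_ge0.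
- exact: RN.f_ge0.
rewrite [RHS]integral_mkcond; apply: eq_integral => y _.
by rewrite !patchE mem_xsection.
Qed.

End product_density.

Section density_domination.
Local Open Scope ereal_scope.
Context d1 d2 (T1 : measurableType d1) (T2 : measurableType d2) (R : realType).
Variables (P : probability (T1 * T2)%type R).
Variables (P1 : probability T1 R) (P2 : probability T2 R).
Variables (nu1 : {sigma_finite_measure set T1 -> \bar R}).
Variables (nu2 : {sigma_finite_measure set T2 -> \bar R}).
Variables (nu : {sigma_finite_measure set (T1 * T2)%type -> \bar R}).
Hypothesis marg1 : forall A, measurable A -> P (A `*` setT) = P1 A.
Hypothesis marg2 : forall A, measurable A -> P (setT `*` A) = P2 A.
Hypothesis nuE : forall A, measurable A -> nu A = (nu1 \x nu2) A.
Hypothesis dom : P `<< nu.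

Lemma marginal_dominates1 : P1 `<< nu1.
Proof.
apply/null_content_dominatesP => A mA A0; rewrite -marg1//.
have mAT : measurable (A `*` [set: T2]) by exact: measurableX.
move/null_content_dominatesP : dom; apply => //.
apply: etrans (nuE mAT) _; apply: etrans (product_measure1E _ _ mA _) _ => //.
by rewrite [X in X * _]A0 mul0e.
Qed.

Lemma marginal_dominates2 : P2 `<< nu2.
Proof.
apply/null_content_dominatesP => A mA A0; rewrite -marg2//.
have mAT : measurable ([set: T1] `*` A) by exact: measurableX.
move/null_content_dominatesP : dom; apply => //.
apply: etrans (nuE mAT) _; apply: etrans (product_measure1E _ _ _ mA) _ => //.
by rewrite [X in _ * X]A0 mule0.
Qed.

Local Notation g := (product_density P1 P2 nu1 nu2).

Lemma integral_product_density_nu A : measurable A ->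
  \int[nu]_(p in A) g p = (P1 \x P2) A.
Proof.
move=> mA; rewrite -(integral_product_density marginal_dominates1
  marginal_dominates2)//.
by apply: eq_measure_integral => B mB _; exact: nuE.
Qed.

Lemma integrable_product_density : nu.-integrable setT g.
Proof.
apply/integrableP; split.
  exact: measurable_product_density marginal_dominates1 marginal_dominates2.
under eq_integral.
  move=> p _; rewrite gee0_abs; last first.
    exact: product_density_ge0 marginal_dominates1 marginal_dominates2 _.
  over.
rewrite integral_product_density_nu//.
apply: le_lt_trans (ltry 1).
exact: (@probability_le1 _ _ _ (P1 \x P2) setT measurableT).
Qed.

(** On a null set of the product of the marginals, one of the two marginal
    densities vanishes nu-almost everywhere; and a law does not charge the zeros
    of its own density. *)
Lemma dominates_product : P `<< (P1 \x P2).
Proof.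
apply/null_content_dominatesP => A mA A0.
have dom1 := marginal_dominates1; have dom2 := marginal_dominates2.
have mg : measurable_fun setT g by exact: measurable_product_density.
have g0 : {ae nu, forall p, A p -> g p = 0}.
  apply/(ae_eq_integral_abs nu mA (measurable_funTS mg)).
  under eq_integral do rewrite gee0_abs ?product_density_ge0//.
  exact: etrans (integral_product_density_nu mA) A0.
have null_zeros d (T : measurableType d) (m : probability T R)
    (n : {sigma_finite_measure set T -> \bar R}) : m `<< n ->
    measurable [set x | RN.f m n x = 0] /\ m [set x | RN.f m n x = 0] = 0.
  move=> mn; have mf : measurable_fun setT (RN.f m n).
    exact: measurable_int (RN.f_integrable mn).
  have mZ : measurable [set x | RN.f m n x = 0].
    by rewrite -[X in measurable X]setTI; exact: emeasurable_fun_eq.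
  by split => //; rewrite (RN.f_integral mn)//; exact: integral0_eq.
have [mZ1 Z1] := null_zeros _ _ _ _ dom1.
have [mZ2 Z2] := null_zeros _ _ _ _ dom2.
case: g0 => N [mN N0 AN].
have PN : P N = 0 by move/null_content_dominatesP : dom; apply.
pose Z1T := [set x | RN.f P1 nu1 x = 0] `*` [set: T2].
pose TZ2 := [set: T1] `*` [set x | RN.f P2 nu2 x = 0].
have mZ1T : measurable Z1T by exact: measurableX.
have mTZ2 : measurable TZ2 by exact: measurableX.
apply: (@subset_measure0 _ _ _ P _ (N `|` Z1T `|` TZ2)) => //.
- by apply: measurableU => //; exact: measurableU.
- move=> p Ap; have [Np|Np] := pselect (N p); first by left; left.
  have /eqP : g p = 0.
    by apply: contrapT => gp; apply: Np; apply: AN => /(_ Ap).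
  rewrite mule_eq0 => /orP[/eqP z|/eqP z]; first by left; right.
  by right.
- have P1T : P Z1T = 0 by rewrite marg1.
  have PT2 : P TZ2 = 0 by rewrite marg2.
  apply: (etrans (measureU0 (measurableU _ _ mN mZ1T) mTZ2 PT2)).
  by rewrite -PN; exact: measureU0.
Qed.

(** A property of one coordinate fails at most on a null strip. *)
Lemma ae_fst (Q : T1 -> Prop) :
  {ae nu1, forall x, Q x} -> {ae nu, forall p, Q p.1}.
Proof.
move=> [N [mN N0 QN]]; exists (N `*` setT); split.
- exact: measurableX.
- apply: etrans (nuE _) _; first exact: measurableX.
  apply: etrans (product_measure1E _ _ mN _) _ => //.
  by rewrite [X in X * _]N0 mul0e.
- by move=> p Qp; split => //; apply: QN.
Qed.

Lemma ae_snd (Q : T2 -> Prop) :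
  {ae nu2, forall x, Q x} -> {ae nu, forall p, Q p.2}.
Proof.
move=> [N [mN N0 QN]]; exists (setT `*` N); split.
- exact: measurableX.
- apply: etrans (nuE _) _; first exact: measurableX.
  apply: etrans (product_measure1E _ _ _ mN) _ => //.
  by rewrite [X in _ * X]N0 mule0.
- by move=> p Qp; split => //; apply: QN.
Qed.

(** Both sides are the integrated and the pointwise form of the same comparison
    of densities. *)
Lemma le_density_product (M : R) : (0 <= M)%R ->
  {ae nu, forall x, M%:E * (density P1 nu1 x.1 * density P2 nu2 x.2)
     <= density P nu x} <->
  (forall A, measurable A -> M%:E * (P1 \x P2) A <= P A).
Proof.
move=> M0.
have dom1 := marginal_dominates1; have dom2 := marginal_dominates2.
have eq1 : {ae nu, forall p, RN.f P1 nu1 p.1 = density P1 nu1 p.1}.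
  apply: (@ae_fst (fun x => RN.f P1 nu1 x = density P1 nu1 x)).
  have := ae_eq_Radon_Nikodym_SigmaFinite dom1 measurableT.
  by apply: filterS => x; apply.
have eq2 : {ae nu, forall p, RN.f P2 nu2 p.2 = density P2 nu2 p.2}.
  apply: (@ae_snd (fun x => RN.f P2 nu2 x = density P2 nu2 x)).
  have := ae_eq_Radon_Nikodym_SigmaFinite dom2 measurableT.
  by apply: filterS => x; apply.
have eqP : {ae nu, forall p, RN.f P nu p = density P nu p}.
  have := ae_eq_Radon_Nikodym_SigmaFinite dom measurableT.
  by apply: filterS => x; apply.
have eqg : {ae nu, forall p, g p = density P1 nu1 p.1 * density P2 nu2 p.2}.
  by apply: filterS2 eq1 eq2 => p /= <- <-.
have mg : measurable_fun setT g by exact: measurable_product_density.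
have mf : measurable_fun setT (RN.f P nu).
  exact: measurable_int (RN.f_integrable dom).
have intMg A : measurable A ->
    \int[nu]_(p in A) (M%:E * g p) = M%:E * (P1 \x P2) A.
  move=> mA; rewrite ge0_integralZl//; last 2 first.
  - exact: measurable_funTS.
  - by move=> x _; exact: product_density_ge0.
  by rewrite integral_product_density_nu.
split=> [Mle A mA|Mle].
  rewrite -intMg// (RN.f_integral dom)//.
  apply: ae_le_integral => //.
  - by apply: emeasurable_funM.
  - by move=> x; rewrite mule_ge0 ?lee_fin//; exact: product_density_ge0.
  - exact: RN.f_ge0.
  - by apply: filterS3 Mle eqg eqP => p + -> ->.
have : {ae nu, forall x, M%:E * g x <= RN.f P nu x}.
  apply: integral_le_ae.
  - exact: integrableZl integrable_product_density.
  - exact: RN.f_integrable.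
  - by move=> A mA; rewrite intMg// -RN.f_integral//; exact: Mle.
move=> {}Mle; by apply: filterS3 Mle eqg eqP => p + <- <-.
Qed.

End density_domination.

(** * Difference quotients *)

Section difference_quotient.
Context {R : realType}.
Implicit Types (f : R -> R) (x l : R).

Lemma derivable_quotient_cvg f x : derivable f x 1 ->
  (f y - f x) / (y - x) @[y --> x^'] --> derive1 f x.
Proof.
move=> df; have fx : h^-1 *: (f (h + x) - f x) @[h --> 0^'] --> derive1 f x.
  have := df; rewrite /derivable => /cvg_ex[l fl].
  have fE : (fun h : R => h^-1 *: ((f \o shift x) (h *: 1) - f x)) =
      (fun h : R => h^-1 *: (f (h + x) - f x)).
    by apply/funext => h /=; rewrite [h *: 1]mulr1.
  rewrite /derive1; have -> : lim (h^-1 *: (f (h + x) - f x) @[h --> 0^']) = l.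
    by apply/cvg_lim => //; rewrite -fE.
  by rewrite -fE.
apply/cvgrPdist_lt => e e0.
have /cvgrPdist_lt/(_ _ e0) := fx.
move=> /nbhs_ballP[d /= d0 Hd]; apply/nbhs_ballP; exists d => //= y xy yx.
have := Hd (y - x); rewrite /= subrK mulrC; apply.
  by rewrite /ball/= sub0r opprB.
by rewrite subr_eq0.
Qed.

(** The difference quotients at v are nondecreasing in s, so the one at s is
    squeezed between those at rational points on both sides of s, whose limits
    are close to G s by continuity. *)
Lemma quotient_cvg_monotone_family (D : R -> R -> R) (G : R -> R) (s v : R) :
  (forall s1 s2 v1 v2, s1 <= s2 -> v1 <= v2 ->
    D s1 v2 - D s1 v1 <= D s2 v2 - D s2 v1) ->
  {for s, continuous G} ->
  (forall q : rat,
    (D (ratr q) y - D (ratr q) v) / (y - v) @[y --> v^'] --> G (ratr q)) ->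
  (D s y - D s v) / (y - v) @[y --> v^'] --> G s.
Proof.
move=> Dinc Gs Dq.
have Qle s1 s2 y : s1 <= s2 -> y != v ->
    (D s1 y - D s1 v) / (y - v) <= (D s2 y - D s2 v) / (y - v).
  move=> s12; rewrite neq_lt => /orP[yv|vy]; last first.
    by rewrite ler_pM2r ?invr_gt0 ?subr_gt0// Dinc// ltW.
  rewrite ler_nM2r ?invr_lt0 ?subr_lt0//.
  by rewrite -lerN2 !opprB Dinc// ltW.
apply/cvgrPdist_lt => e e0.
have /cvgrPdist_lt/(_ _ e0)/nbhs_ballP[del /= del0 Hdel] := Gs.
have [q1] : exists q, ratr q \in `]s - del, s[.
  by apply: rat_in_itvoo; rewrite ltrBlDr ltrDl.
rewrite in_itv/= => /andP[q1l q1r].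
have [q2] : exists q, ratr q \in `]s, s + del[.
  by apply: rat_in_itvoo; rewrite ltrDl.
rewrite in_itv/= => /andP[q2l q2r].
have Gq1 : G s - e < G (ratr q1).
  have /Hdel/= : ball s del (ratr q1).
    by rewrite /ball/= ltr_distlC q1l (lt_trans q1r)// ltrDl.
  by rewrite ltr_distlC => /andP[].
have Gq2 : G (ratr q2) < G s + e.
  have /Hdel/= : ball s del (ratr q2).
    by rewrite /ball/= ltr_distlC q2r andbT (lt_trans _ q2l)// ltrBlDr ltrDl.
  by rewrite ltr_distlC => /andP[].
near=> y; have yv : y != v by near: y; exact: nbhs_dnbhs_neq.
rewrite ltr_distlC; apply/andP; split.
  apply: lt_le_trans (Qle (ratr q1) s y (ltW q1r) yv).
  by near: y; exact: cvgr_gt (Dq q1) _ Gq1.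
apply: le_lt_trans (Qle s (ratr q2) y (ltW q2l) yv) _.
by near: y; exact: cvgr_lt (Dq q2) _ Gq2.
Unshelve. all: by end_near. Qed.

End difference_quotient.

(** * Primitives of integrable functions *)

Section indefinite_integral.
Context {R : realType}.
Local Notation leb := (@lebesgue_measure R).
Variable f : R -> R.
Hypothesis intf : leb.-integrable setT (EFin \o f).

Definition primitive (x : R) : R := \int[leb]_(t in `]-oo, x]) f t.

(** Lebesgue differentiation, with difference quotients based at x. *)
Lemma ae_primitive_derivative :
  {ae leb, forall x,
    (primitive y - primitive x) / (y - x) @[y --> x^'] --> f x}.
Proof.
have int_ray (y : R) : leb.-integrable `]-oo, y] (EFin \o f).
  exact: integrableS intf.
have locf : locally_integrable setT f.
  by apply: open_integrable_locally => //; exact: openT.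
have := FTC1Ny int_ray locf.
apply: filterS; first exact: (ae_filter_ringOfSetsType leb).
by move=> x [/derivable_quotient_cvg + fx]; rewrite fx.
Qed.

Lemma primitiveB (x y : R) : x <= y ->
  primitive y - primitive x = \int[leb]_(t in `]x, y]) f t.
Proof.
move=> xy; rewrite /primitive.
rewrite (@itv_bndbnd_setU _ _ -oo%O (BRight x) (BRight y))//.
rewrite Rintegral_setU//=; last 2 first.
- by apply: integrableS intf => //; exact: measurableU.
- apply/disj_set2P; rewrite -subset0 => z/=; rewrite !in_itv/= => -[zx /andP[]].
  by rewrite ltNge zx.
by rewrite addrAC subrr add0r.
Qed.

(** Absolute continuity of the integral. *)
Lemma continuous_primitive : continuous primitive.
Proof.
move=> x; apply/cvgrPdist_lt => e e0.
have [d [d0 Hd]] := integral_normr_continuous intf e0.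
have small (a b : R) : a <= b -> b - a < d -> `|primitive b - primitive a| < e.
  move=> ab bad; rewrite primitiveB//.
  apply: (@le_lt_trans _ _ (\int[leb]_(t in `]a, b]) `|f t|)).
    by apply: le_normr_Rintegral => //; exact: integrableS intf.
  apply: Hd => //=; rewrite lebesgue_measure_itv/= lte_fin.
  by case: ifPn => //; rewrite lte_fin.
apply/nbhs_ballP; exists d => //= y; rewrite /ball/= => xyd.
have [xy|yx] := leP x y.
  by rewrite distrC small// (le_lt_trans (ler_norm _))// distrC.
by rewrite small// ?ltW// (le_lt_trans (ler_norm _)).
Qed.

End indefinite_integral.

(** * Mixed derivative of an absolutely continuous distribution function *)

Section plane_density.
Context {R : realType}.
Local Notation T := (measurableTypeR R).
Local Notation leb := (@lebesgue_measure R).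
Local Notation leb2 := (leb \x leb)%E.
Variable c : T * T -> R.
Hypothesis c0 : forall p, 0 <= c p.
Hypothesis intc : leb2.-integrable setT (EFin \o c).

Definition plane_cdf (s v : R) : R :=
  \int[leb2]_(p in `]-oo, s] `*` `]-oo, v]) c p.

(** The candidate for the partial derivative of plane_cdf in its second
    variable.  Where the section of c is not integrable the value is a junk
    real number, which affects only a null set of w. *)
Definition partial_cdf (s w : R) : R := primitive (fun t => c (t, w)) s.

Let K s w := (\int[leb]_(t in `]-oo, s]) (c (t, w))%:E)%E.
Let Ktot w := (\int[leb]_t (c (t, w))%:E)%E.

Let mc : measurable_fun setT (EFin \o c).
Proof. exact: measurable_int intc. Qed.

Let mcw w : measurable_fun setT (fun t => (c (t, w))%:E).
Proof. exact: (measurableT_comp mc). Qed.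

Let mK s : measurable_fun setT (K s).
Proof.
pose A : set (T * T) := `]-oo, s]%classic `*` setT.
have mA : measurable A by exact: measurableX.
rewrite (_ : K s = fubini_G leb ((EFin \o c) \_ A)).
  apply: measurable_fun_fubini_tonelli_G.
    by apply/(measurable_restrictT _ mA); exact: measurable_funTS.
  by move=> p; rewrite patchE; case: ifPn => // _; rewrite lee_fin.
apply/funext => w; rewrite /K /fubini_G [LHS]integral_mkcond.
apply: eq_integral => t _; rewrite !patchE; congr (if _ then _ else _).
by apply/idP/idP; rewrite !inE /A/=; [move=> ->|case].
Qed.

Let K_ge0 s w : (0 <= K s w)%E.
Proof. by apply: integral_ge0 => t _; rewrite lee_fin. Qed.

Let intK s : leb.-integrable setT (K s).
Proof.
apply: (@le_integrable _ _ _ _ _ measurableT _ Ktot) => //.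
  move=> w _; rewrite !gee0_abs//; last 1 first.
    by apply: integral_ge0 => t _; rewrite lee_fin.
  by apply: ge0_subset_integral => // t _; rewrite lee_fin.
apply/integrableP; split.
  apply: (measurable_fun_fubini_tonelli_G (m1 := leb) (EFin \o c)) => //.
under eq_integral.
  move=> w _; rewrite gee0_abs; last first.
    by apply: integral_ge0 => t _; rewrite lee_fin.
  over.
have c0E p : (0 <= (EFin \o c) p)%E by rewrite lee_fin.
apply: (@le_lt_trans _ _ (\int[leb2]_p (EFin \o c) p)%E).
  by rewrite (fubini_tonelli2 (m1 := leb) (m2 := leb) _ mc c0E).
have /integrableP[_] := intc.
by under eq_integral do rewrite gee0_abs ?lee_fin//.
Qed.

Let partial_cdfE s : partial_cdf s = fine \o K s.
Proof. by []. Qed.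

Let partial_cdf_ae s : {ae leb, forall w, (partial_cdf s w)%:E = K s w}.
Proof.
have := integrable_ae measurableT (intK s).
apply: (@filterS _ _ (ae_filter_ringOfSetsType leb)).
by move=> w /(_ Logic.I) Kfin; rewrite partial_cdfE/= fineK.
Qed.

Let integrable_partial_cdf s : leb.-integrable setT (EFin \o partial_cdf s).
Proof.
apply: (@le_integrable _ _ _ _ _ measurableT _ (K s)) => //.
  by apply/measurable_EFinP; rewrite partial_cdfE; exact: measurableT_comp.
move=> w _; rewrite partial_cdfE/=.
by case: (K s w) => [r| |] //=; rewrite normr0 leey.
Qed.

(** Tonelli, integrating first along the horizontal lines. *)
Lemma plane_cdfE s v : plane_cdf s v = primitive (partial_cdf s) v.
Proof.
rewrite /plane_cdf /primitive /Rintegral; congr fine.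
have mB : measurable (`]-oo, s]%classic `*` `]-oo, v]%classic : set (T * T)).
  exact: measurableX.
rewrite integral_mkcond fubini_tonelli2/=; last 2 first.
- by apply/(measurable_restrictT _ mB); exact: measurable_funTS.
- by move=> p; rewrite patchE; case: ifPn => // _; rewrite lee_fin.
transitivity (\int[leb]_(w in `]-oo, v]) K s w)%E; last first.
  apply: ae_eq_integral => //.
  - exact: measurable_funTS.
  - exact: measurable_funTS (measurable_int _ (integrable_partial_cdf s)).
  - have := partial_cdf_ae s.
    by apply: (@filterS _ _ (ae_filter_ringOfSetsType leb)) => w ->.
rewrite [RHS]integral_mkcond; apply: eq_integral => w _.
rewrite /fubini_G patchE; case: ifPn => wv.
  rewrite /K [RHS]integral_mkcond; apply: eq_integral => t _.
  rewrite !patchE; congr (if _ then _ else _).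
  apply/idP/idP; rewrite !inE/=; first by case.
  by move=> ts; split => //; rewrite inE in wv.
rewrite integral0_eq// => t _; rewrite patchE memNset//= => -[_ wv'].
by move: wv; rewrite notin_setE.
Qed.

(** Both differences are integrals of c over strips, the first strip lying
    inside the second. *)
Lemma plane_cdf_incr s1 s2 v1 v2 : s1 <= s2 -> v1 <= v2 ->
  plane_cdf s1 v2 - plane_cdf s1 v1 <= plane_cdf s2 v2 - plane_cdf s2 v1.
Proof.
move=> s12 v12.
pose strip s : set (T * T) := `]-oo, s]%classic `*` `]v1, v2]%classic.
have mstrip s : measurable (strip s) by exact: measurableX.
have stripE s : plane_cdf s v2 - plane_cdf s v1 = \int[leb2]_(p in strip s) c p.
  have mv v : measurable
      (`]-oo, s]%classic `*` `]-oo, v]%classic : set (T * T)).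
    exact: measurableX.
  rewrite /plane_cdf (@itv_bndbnd_setU _ _ -oo%O (BRight v1) (BRight v2))//.
  have -> : `]-oo, s] `*` (`]-oo, v1] `|` `]v1, v2]) =
      (`]-oo, s] `*` `]-oo, v1]) `|` strip s :> set (T * T).
    apply/seteqP; split => -[t w]/=; first by move=> [? []]; [left|right].
    by move=> [] []; split => //; [left|right].
  rewrite Rintegral_setU//=.
  - by rewrite addrAC subrr add0r.
  - by apply: integrableS intc => //; exact: measurableU.
  - apply/disj_set2P; rewrite -subset0 => -[t w]; rewrite /strip/= !in_itv/=.
    by move=> [[_ wv1] [_ /andP[]]]; rewrite ltNge wv1.
have fin s : (\int[leb2]_(p in strip s) (c p)%:E \is a fin_num)%E.
  by apply: integrable_fin_num => //; exact: integrableS intc.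
rewrite !stripE; apply: fine_le => //.
apply: ge0_subset_integral => //.
- exact: measurable_funTS.
- by move=> p _; rewrite lee_fin.
- move=> [t w]; rewrite /strip/= !in_itv/= => -[ts1 ->].
  by rewrite (le_trans ts1).
Qed.

(** The exceptional set of v must not depend on s: this is what allows the
    partial derivative in v to be differentiated in turn.  It is the union of the
    null sets attached to rational s, and of the v whose section is not
    integrable. *)
Lemma ae_mixed_derivative :
  {ae leb, forall v, {ae leb, forall u,
    (forall s, (plane_cdf s y - plane_cdf s v) / (y - v) @[y --> v^'] -->
       partial_cdf s v) /\
    (partial_cdf y v - partial_cdf u v) / (y - u) @[y --> u^'] --> c (u, v)}}.
Proof.
have rat_ae : {ae leb, forall v, forall n : nat,
    let q := odflt 0 (unpickle n) in
    (plane_cdf (ratr q) y - plane_cdf (ratr q) v) / (y - v) @[y --> v^'] -->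
      partial_cdf (ratr q) v}.
  (* Rationals are enumerated by their codes; other codes stand for 0. *)
  apply: ae_foralln => n; set q := odflt _ _.
  have := ae_primitive_derivative (integrable_partial_cdf (ratr q)).
  apply: (@filterS _ _ (ae_filter_ringOfSetsType leb)) => v /=.
  by rewrite (_ : plane_cdf (ratr q) = primitive (partial_cdf (ratr q)))//;
    apply/funext => w; rewrite plane_cdfE.
apply: (@filterS2 _ _ (ae_filter_ringOfSetsType leb)) rat_ae
  (ae_integrable2 intc) => v vrat intcv.
have intcv' : leb.-integrable setT (EFin \o (fun t => c (t, v))) by [].
have := ae_primitive_derivative intcv'.
apply: (@filterS _ _ (ae_filter_ringOfSetsType leb)) => u cu; split => // s.
apply: (@quotient_cvg_monotone_family _ _ (fun s => partial_cdf s v)).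
- exact: plane_cdf_incr.
- exact: continuous_primitive.
- by move=> q; have := vrat (pickle q); rewrite /= pickleK.
Qed.

End plane_density.

(** * From the density of a copula to its measure *)

Section uniform_square.
Context {R : realType}.
Local Notation T := (measurableTypeR R).
Local Notation leb := (@lebesgue_measure R).
Local Notation leb2 := (leb \x leb)%E.
Local Notation unif := (uniform_prob (@ltr01 R)).
Local Notation unif2 := (unif \x unif)%E.
Let sq : set (T * T) := unit_square.

Let msq : measurable sq. Proof. exact: measurableX. Qed.

(** The boundary of the square is null, so the open square may be used on the
    right. *)
Lemma uniform_squareE B : measurable B -> unif2 B = leb2 (B `&` sq).
Proof.
move=> mB.
rewrite (@product_measure_unique _ _ _ _ _ unif unif (mrestr leb2 msq))//.
move=> X Y mX mY; pose oo01 : set T := `]0, 1[%classic.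
transitivity (leb2 ((X `&` oo01) `*` (Y `&` oo01))).
  by rewrite setXI.
have moo01 : measurable oo01 by exact: measurable_itv.
rewrite product_measure1E//; [|exact: measurableI..].
have oo (Z : set R) : measurable Z -> unif Z = leb (Z `&` `]0, 1[%classic).
  move=> mZ; rewrite -[LHS]/(unif01 Z) unif01_setIoo// unif01E//.
    rewrite -setIA [X in leb (_ `&` X)]setIidl//.
    by move=> x /=; rewrite !in_itv/= => /andP[/ltW -> /ltW ->].
  exact: measurableI.
by congr (_ * _)%E; apply/esym/oo.
Qed.

Lemma uniform_square_dominates : unif2 `<< leb2.
Proof.
apply/null_content_dominatesP => A mA A0; apply: etrans (uniform_squareE mA) _.
apply: (@subset_measure0 _ _ _ leb2 _ A) => //; exact: measurableI.
Qed.

End uniform_square.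

Section lebesgue_plane.
Context {R : realType}.
Local Notation T := (measurableTypeR R).
Local Notation leb := (@lebesgue_measure R).

(** Named in order to bear a sigma-finite structure. *)
Definition lebesgue_plane : set (T * T) -> \bar R := (leb \x leb)%E.

HB.instance Definition _ := isMeasure.Build _ _ _ lebesgue_plane
  (measure0 (leb \x leb)%E) (measure_ge0 (leb \x leb)%E)
  (@measure_semi_sigma_additive _ _ _ (leb \x leb)%E).

Let lebesgue_plane_sigma_finite : sigma_finite setT lebesgue_plane.
Proof.
have /sigma_finiteP[F [TF ndF Foo]] := sigma_finiteT leb.
exists (fun n => F n `*` F n).
  rewrite -setXTT TF predeqE => -[x y]; split.
    move=> [/= [n _ Fnx] [k _ Fky]]; exists (maxn n k) => //; split.
    - by move: x Fnx; exact/subsetPset/ndF/leq_maxl.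
    - by move: y Fky; exact/subsetPset/ndF/leq_maxr.
  by move=> [n _ []/= ? ?]; split; exists n.
move=> k; have [mF Foo'] := Foo k; split; first exact: measurableX.
by rewrite /lebesgue_plane product_measure1E// lte_mul_pinfty// ge0_fin_numE.
Qed.

HB.instance Definition _ := Measure_isSigmaFinite.Build _ _ _ lebesgue_plane
  lebesgue_plane_sigma_finite.

End lebesgue_plane.

Section copula_density.
Context {R : realType}.
Local Notation T := (measurableTypeR R).
Local Notation leb := (@lebesgue_measure R).
Local Notation leb2 := (leb \x leb)%E.
Local Notation unif := (uniform_prob (@ltr01 R)).
Local Notation unif2 := (unif \x unif)%E.
Variable mu : probability (T * T)%type R.
Hypothesis mu_leb2 : mu `<< lebesgue_plane.
Variable C : R -> R -> R.
Hypothesis muC : forall u v : R, u \in `[0, 1] -> v \in `[0, 1] ->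
  (C u v)%:E = mu (`]-oo, u] `*` `]-oo, v]).

Let c (p : T * T) : R := fine (RN.f mu lebesgue_plane p).

Let cE : EFin \o c = RN.f mu lebesgue_plane.
Proof. by apply/funext => p /=; rewrite fineK// RN.f_fin_num. Qed.

Let c0 p : 0 <= c p.
Proof. by rewrite fine_ge0// RN.f_ge0. Qed.

Let intc : leb2.-integrable setT (EFin \o c).
Proof.
have : lebesgue_plane.-integrable setT (EFin \o c).
  by rewrite cE; exact: RN.f_integrable.
exact.
Qed.

Let muE A : measurable A -> mu A = (\int[leb2]_(p in A) (c p)%:E)%E.
Proof.
move=> mA; rewrite (RN.f_integral mu_leb2)//; apply: eq_integral => p _.
by rewrite -cE.
Qed.

Let plane_cdfC u v : u \in `[0, 1] -> v \in `[0, 1] -> plane_cdf c u v = C u v.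
Proof.
move=> u01 v01; apply: EFin_inj; rewrite muC//.
have mq : measurable (`]-oo, u]%classic `*` `]-oo, v]%classic : set (T * T)).
  exact: measurableX.
rewrite /plane_cdf /Rintegral -[X in fine X]muE// fineK// fin_num_measure//.
Qed.

(** Inside the open square the one-sided conventions at the boundary are
    harmless, and C coincides there with plane_cdf. *)
Lemma ae_copula_density : {ae leb, forall v, {ae leb, forall u,
  v \in `]0, 1[ -> u \in `]0, 1[ -> is_copula_density_at C u v (c (u, v))}}.
Proof.
have oocc (x : R) : x \in `]0, 1[ -> x \in `[0, 1].
  by rewrite !in_itv/= => /andP[/ltW -> /ltW ->].
have := ae_mixed_derivative c0 intc.
apply: (@filterS _ _ (ae_filter_ringOfSetsType leb)) => v.
apply: (@filterS _ _ (ae_filter_ringOfSetsType leb)).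
move=> u [Dv Du] /oocc v01 /oocc u01.
exists (fun s => partial_cdf c s v); split.
  apply: filterS (withinT _ _) => s s01.
  have : (plane_cdf c s y - plane_cdf c s v) / (y - v)
      @[y --> within `[0, 1] v^'] --> partial_cdf c s v.
    exact: cvg_trans (cvg_app _ (cvg_within _)) (Dv s).
  apply: cvg_trans; apply: near_eq_cvg.
  apply: filterS (withinT _ _) => y y01.
  by rewrite !plane_cdfC.
exact: cvg_trans (cvg_app _ (cvg_within _)) Du.
Qed.

(** The bound on the density holds for almost every u on almost every horizontal
    line, which is enough to compare the iterated integrals. *)
Lemma copula_density_ge (M : R) : 0 <= M ->
  (forall u v d : R, u \in `[0, 1] -> v \in `[0, 1] ->
    is_copula_density_at C u v d -> M <= d) ->
  forall B, measurable B -> (M%:E * unif2 B <= mu B)%E.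
Proof.
move=> M0 Mle B mB.
have oocc (x : R) : x \in `]0, 1[ -> x \in `[0, 1].
  by rewrite !in_itv/= => /andP[/ltW -> /ltW ->].
pose S : set (T * T) := B `&` unit_square.
have mS : measurable S by apply: measurableI => //; exact: measurableX.
rewrite uniform_squareE//.
apply: (@le_trans _ _ (mu S)); last first.
  by rewrite le_measure ?inE//; exact: subIsetl.
rewrite -integral_cst// muE//.
rewrite [leLHS]integral_mkcond [leRHS]integral_mkcond.
have mSf (f : T * T -> \bar R) : measurable_fun setT f ->
    measurable_fun setT (f \_ S).
  by move=> mf; apply/(measurable_restrictT _ mS); exact: measurable_funTS.
have Sf0 (f : T * T -> \bar R) : (forall p, (0 <= f p)%E) ->
    forall p, (0 <= (f \_ S) p)%E.
  by move=> f0 p; rewrite patchE; case: ifPn.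
have mM := mSf _ (measurable_cst M%:E).
have mc := mSf _ (measurable_int _ intc).
have SM0 := Sf0 _ (fun=> M0 : (0 <= M%:E)%E).
have Sc0 := Sf0 _ (fun p => c0 p : (0 <= (c p)%:E)%E).
rewrite (fubini_tonelli2 (m1 := leb) (m2 := leb) _ mM SM0).
rewrite (fubini_tonelli2 (m1 := leb) (m2 := leb) _ mc Sc0).
apply: ae_ge0_le_integral => //.
- by move=> v _; exact: integral_ge0.
- exact: measurable_fun_fubini_tonelli_G.
- by move=> v _; exact: integral_ge0.
- exact: measurable_fun_fubini_tonelli_G.
have := ae_copula_density; apply: (@filterS _ _ (ae_filter_ringOfSetsType leb)).
move=> v aeu _; apply: ae_ge0_le_integral => //.
- exact: (measurableT_comp mM).
- exact: (measurableT_comp mc).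
apply: (@filterS _ _ (ae_filter_ringOfSetsType leb)) aeu => u duv _.
rewrite !patchE; case: ifPn => //; rewrite inE => -[_ [/= u01 v01]].
by rewrite lee_fin; apply: (Mle u v); [exact: oocc..|exact: duv].
Qed.

End copula_density.

Section lebesgue_copy.
Context {R : realType}.
Local Notation T := (measurableTypeR R).
Local Notation unif2 := (uniform_prob (@ltr01 R) \x uniform_prob (@ltr01 R))%E.

(** The identity, as a measurable map between two displays of the same plane. *)
Definition to_lebesgue (p : R * R) : T * T := p.

Let measurable_to_lebesgue : measurable_fun setT to_lebesgue.
Proof. by move=> _ A mA; rewrite setTI. Qed.

HB.instance Definition _ := isMeasurableFun.Build _ _ _ _ to_lebesgue
  measurable_to_lebesgue.

Definition of_lebesgue (p : T * T) : R * R := p.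

Let measurable_of_lebesgue : measurable_fun setT of_lebesgue.
Proof. by move=> _ A mA; rewrite setTI. Qed.

HB.instance Definition _ := isMeasurableFun.Build _ _ _ _ of_lebesgue
  measurable_of_lebesgue.

Lemma unif01X_of_lebesgue (B : set (R * R)) : measurable B ->
  (@unif01 R \x @unif01 R)%E B = unif2 B.
Proof.
move=> mB; rewrite (@product_measure_unique _ _ _ _ _ unif01 unif01
  (distribution unif2 of_lebesgue))// => X Y mX mY.
exact: product_measure1E.
Qed.

(** Transfer of copula_density_ge along the identity of the plane. *)
Lemma copula_density_measure_ge (mu : probability (R * R)%type R)
    (C : R -> R -> R) (M : R) :
  mu `<< (@unif01 R \x @unif01 R)%E ->
  (forall u v : R, u \in `[0, 1] -> v \in `[0, 1] ->
    (C u v)%:E = mu (`]-oo, u] `*` `]-oo, v])) ->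
  0 <= M ->
  (forall u v c : R, u \in `[0, 1] -> v \in `[0, 1] ->
    is_copula_density_at C u v c -> M <= c) ->
  forall B, measurable B -> (M%:E * (@unif01 R \x @unif01 R) B <= mu B)%E.
Proof.
move=> /null_content_dominatesP mu_unif muC M0 Mle B mB.
rewrite unif01X_of_lebesgue//.
apply: (@copula_density_ge R (distribution mu to_lebesgue) _ C) => //.
apply/null_content_dominatesP => A mA A0; apply: mu_unif => //.
apply: etrans (unif01X_of_lebesgue mA) _.
by have /null_content_dominatesP := @uniform_square_dominates R; apply.
Qed.

End lebesgue_copy.

(** * Mixtures with the uniform law on the square *)

(** The residual is the normalized difference of the two measures. *)
Lemma mixture_residual d (T : measurableType d) (R : realType)
    (mu m : probability T R) (M : R) : M < 1 ->
  (forall A, measurable A -> (M%:E * m A <= mu A)%E) ->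
  exists r : probability T R, forall A, measurable A ->
    mu A = (M%:E * m A + (1 - M)%:E * r A)%E.
Proof.
move=> M1 le_m_mu.
have M1' : 0 < 1 - M by rewrite subr_gt0.
pose ch := cscale (1 - M)^-1 (cadd (charge_of_finite_measure mu)
  (cscale (- M) (charge_of_finite_measure m))).
(* A charge is turned into a measure when it is nonnegative on all sets, so the
   difference is set to 0 on nonmeasurable ones. *)
pose nu := crestr0 ch (@measurableT _ T).
have nuE A : measurable A -> nu A = ((1 - M)^-1%:E * (mu A - M%:E * m A))%E.
  move=> mA; rewrite /nu /crestr0 mem_set// /crestr setIT.
  by rewrite -mulNe -EFinN.
have fin_Mm A : measurable A -> (M%:E * m A \is a fin_num)%E.
  by move=> mA; rewrite fin_numM// fin_num_measure.
have nu_ge0 A : (0 <= nu A)%E.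
  have [mA|mA] := pselect (measurable A); last by rewrite /nu /crestr0 memNset.
  rewrite nuE//; apply: mule_ge0; first by rewrite lee_fin invr_ge0 ltW.
  by rewrite suber_ge0 ?le_m_mu// fin_Mm.
have nuT : measure_of_charge nu nu_ge0 setT = 1%E.
  rewrite /measure_of_charge nuE// !probability_setT mule1 -EFinB -EFinM.
  by rewrite mulVf// gt_eqF.
pose build :=
  Measure_isProbability.Build _ _ _ (measure_of_charge nu nu_ge0) nuT.
pose r : probability T R := HB.pack (measure_of_charge nu nu_ge0) build.
exists r => A mA.
rewrite -[r A]/(nu A) nuE// muleA -EFinM mulfV ?gt_eqF// mul1e.
by rewrite addeC subeK// fin_Mm.
Qed.

(** The residual keeps uniform marginals because it agrees with mu and with the
    uniform law wherever these two agree. *)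
Lemma mixture_copula (R : realType) (mu : probability (R * R)%type R)
    (C : R -> R -> R) (M : R) : M < 1 ->
  mu (`[0, 1] `*` `[0, 1]) = 1%E -> uniform_marginals mu ->
  (forall u v : R, u \in `[0, 1] -> v \in `[0, 1] ->
    (C u v)%:E = mu (`]-oo, u] `*` `]-oo, v])) ->
  (forall B, measurable B -> (M%:E * (@unif01 R \x @unif01 R) B <= mu B)%E) ->
  exists Ct : R -> R -> R, is_copula Ct /\
    forall u v : R, u \in `[0, 1] -> v \in `[0, 1] ->
      C u v = M * u * v + (1 - M) * Ct u v.
Proof.
move=> M1 mu01 [mu1 mu2] muC /(mixture_residual M1)[r muE].
pose UU : probability (R * R)%type R := (@unif01 R \x @unif01 R)%E.
have rE A : measurable A -> mu A = UU A -> r A = UU A.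
  move=> mA muUU; have := muE A mA; rewrite muUU.
  have UUfin : (UU A \is a fin_num)%E by rewrite fin_num_measure.
  have rfin : (r A \is a fin_num)%E by rewrite fin_num_measure.
  rewrite -(fineK UUfin) -(fineK rfin) -!EFinM -EFinD => -[e].
  by congr (_%:E); nra.
have UUX (A B : set R) : measurable A -> measurable B ->
    UU (A `*` B) = (unif01 A * unif01 B)%E.
  by move=> mA mB; exact: product_measure1E.
have unif01_01 : @unif01 R `[0, 1]%classic = 1%E.
  by rewrite unif01E// setIid lebesgue_measure_itv/= lte_fin ltr01 sube0.
have [UU1 UU2] := @unif01X_marginals R.
exists (fun u v => fine (r (`]-oo, u] `*` `]-oo, v]))); split.
  exists r; split.
  - rewrite rE; [by rewrite UUX// unif01_01 mule1|exact: measurableX|].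
    by rewrite UUX// unif01_01 mule1.
  - move=> A mA; rewrite rE; [exact: UU1|exact: measurableX|].
    by rewrite mu1//; apply/esym/UU1.
  - move=> A mA; rewrite rE; [exact: UU2|exact: measurableX|].
    by rewrite mu2//; apply/esym/UU2.
  - by move=> u v _ _; rewrite fineK// fin_num_measure//; exact: measurableX.
move=> u v u01 v01; apply: EFin_inj; rewrite muC// muE; last first.
  exact: measurableX.
have rfin : (r (`]-oo, u] `*` `]-oo, v]) \is a fin_num)%E.
  by rewrite fin_num_measure//; exact: measurableX.
rewrite -[X in (M%:E * X + _)%E]/(UU _) UUX// !unif01_ray//.
by rewrite -[X in (_ + _ * X)%E](fineK rfin) -!EFinM -EFinD mulrA.
Qed.

(** * Rectangle increments and mixed derivatives *)

Section lower_bound.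
Context {R : realType}.

Lemma within01_dnbhs_proper (x : R) : x \in `[0, 1] ->
  ProperFilter (within `[0, 1] x^').
Proof.
rewrite in_itv/= => /andP[x0 x1]; apply: Build_ProperFilter.
move=> /nbhs_ballP[e /= e0 xP]; pose d := Num.min (e / 2) (1 / 2).
have d0 : 0 < d by rewrite lt_min; apply/andP; split; lra.
have de : d < e by rewrite gt_min; apply/orP; left; lra.
have d2 : d <= 1 / 2 by rewrite ge_min lexx orbT.
have [x2|x2] := leP x (1 / 2).
  apply: (xP (x + d)).
  - by rewrite /ball/= opprD addNKr normrN gtr0_norm.
  - by rewrite -subr_eq0 addrC addKr gt_eqF.
  - by rewrite /= in_itv/=; apply/andP; split; lra.
apply: (xP (x - d)).
- by rewrite /ball/= opprB addrC subrK gtr0_norm.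
- by rewrite -subr_eq0 addrC addKr oppr_eq0 gt_eqF.
- by rewrite /= in_itv/=; apply/andP; split; lra.
Qed.

Lemma within_dnbhs_neq (D : set R) (x : R) :
  \forall y \near within D x^', y != x.
Proof.
rewrite near_withinE.
by have := @nbhs_dnbhs_neq R x; apply: filterS.
Qed.

(** Dividing the increment on a rectangle by its height and letting the height
    tend to 0 bounds the increments of the partial derivative; dividing by the
    width then bounds its derivative. *)
Lemma copula_density_lower_bound (C : R -> R -> R) (M u v d : R) :
  (forall u1 u2 v1 v2 : R, u1 \in `[0, 1] -> u2 \in `[0, 1] ->
     v1 \in `[0, 1] -> v2 \in `[0, 1] -> u1 <= u2 -> v1 <= v2 ->
     M * (u2 - u1) * (v2 - v1) <= (C u2 v2 - C u2 v1) - (C u1 v2 - C u1 v1)) ->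
  u \in `[0, 1] -> v \in `[0, 1] -> is_copula_density_at C u v d -> M <= d.
Proof.
move=> Cinc u01 v01 [g [gs gu]].
have properu := within01_dnbhs_proper u01.
have properv := within01_dnbhs_proper v01.
have g_incr s1 s2 : s1 \in `[0, 1] -> s2 \in `[0, 1] -> s1 <= s2 ->
    is_deriv01 (C s1) v (g s1) -> is_deriv01 (C s2) v (g s2) ->
    M * (s2 - s1) <= g s2 - g s1.
  move=> s101 s201 s12 ds1 ds2.
  rewrite /is_deriv01 in ds1 ds2; apply: (cvgr_to_ge (cvgB ds2 ds1)).
  near=> y.
  have y01 : y \in `[0, 1] by near: y; exact: withinT.
  have yv : y != v by near: y; exact: within_dnbhs_neq.
  rewrite -[leRHS]/((C s2 y - C s2 v) / (y - v) - (C s1 y - C s1 v) / (y - v)).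
  rewrite -mulrBl; move: yv; rewrite neq_lt => /orP[yv|vy].
    rewrite ler_ndivlMr ?subr_lt0//.
    have := Cinc _ _ _ _ s101 s201 y01 v01 s12 (ltW yv); lra.
  rewrite ler_pdivlMr ?subr_gt0//.
  exact: (Cinc _ _ _ _ s101 s201 v01 y01 s12 (ltW vy)).
have du : is_deriv01 (C u) v (g u).
  by have /nbhs_singleton := gs; apply.
apply: (cvgr_to_ge gu).
near=> s.
have s01 : s \in `[0, 1] by near: s; exact: withinT.
have su : s != u by near: s; exact: within_dnbhs_neq.
have ds : is_deriv01 (C s) v (g s).
  move: s01; near: s; apply: cvg_within; apply: nbhs_dnbhs; exact: gs.
move: su; rewrite neq_lt => /orP[su|us].
  rewrite ler_ndivlMr ?subr_lt0//.
  have := g_incr _ _ s01 u01 (ltW su) ds du; lra.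
rewrite ler_pdivlMr ?subr_gt0//; exact: g_incr (ltW us) du ds.
Unshelve. all: by end_near. Qed.

(** Each side is the mass of a horizontal strip, and the strips are nested. *)
Lemma copula_rectangle (C : R -> R -> R) (u1 u2 v1 v2 : R) : is_copula C ->
  u1 \in `[0, 1] -> u2 \in `[0, 1] -> v1 \in `[0, 1] -> v2 \in `[0, 1] ->
  u1 <= u2 -> v1 <= v2 -> C u1 v2 - C u1 v1 <= C u2 v2 - C u2 v1.
Proof.
move=> [mu [_ _ _ muC]] u1I u2I v1I v2I u12 v12.
pose strip s : set (R * R) := `]-oo, s]%classic `*` `]v1, v2]%classic.
have mstrip s : measurable (strip s) by exact: measurableX.
have mq s v :
    measurable (`]-oo, s]%classic `*` `]-oo, v]%classic : set (R * R)).
  exact: measurableX.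
have stripE s : s \in `[0, 1] -> (C s v2 - C s v1)%:E = mu (strip s).
  move=> sI; rewrite EFinB !muC//.
  have -> : strip s = (`]-oo, s] `*` `]-oo, v2]) `\` (`]-oo, s] `*` `]-oo, v1]).
    apply/seteqP; split => -[x y]; rewrite /strip/= !in_itv/=.
      by move=> [-> /andP[v1y ->]]; split => // -[_]; rewrite leNgt v1y.
    by move=> [[xs ->]] /not_andP[//|/negP]; rewrite -ltNge => ->.
  rewrite measureD ?setIidr//.
    by move=> [x y]/= []; rewrite !in_itv/= => -> /le_trans ->.
  by rewrite ltey_eq fin_num_measure.
rewrite -lee_fin !stripE// le_measure ?inE//.
move=> [x y]; rewrite /strip/= !in_itv/= => -[xu1 ->].
by rewrite (le_trans xu1).
Qed.

End lower_bound.

Unset Implicit Arguments.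
Set Strict Implicit.
Set Printing Implicit Defensive.

Theorem proposition4 (d : measure_display) (T : measurableType d)
    (R : realType) (P : probability T R) (X1 X2 : {RV P >-> R})
    (nu1 nu2 : {sigma_finite_measure set R -> \bar R})
    (nu : {sigma_finite_measure set (R * R)%type -> \bar R})
    (C : R -> R -> R) (M : R)
    (nu_prod : forall A : set (R * R), measurable A -> nu A = (nu1 \x nu2)%E A)
    (nu_abs_cont :
       nu `<< ((@lebesgue_measure R) \x (@lebesgue_measure R))%E)
    (PX_abs_cont : distribution P (pair_RV X1 X2) `<< nu)
    (C_copula : is_copula_of X1 X2 C)
    (M_gt0 : 0 < M) (M_lt1 : M < 1) :
  let cond1 := {ae nu, forall x : R * R,
    (M%:E * (density (distribution P X1) nu1 x.1
               * density (distribution P X2) nu2 x.2)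
     <= density (distribution P (pair_RV X1 X2)) nu x)%E} in
  let cond2 := forall u v c : R, u \in `[0, 1] -> v \in `[0, 1] ->
    is_copula_density_at C u v c -> M <= c in
  let cond3 := exists Ct : R -> R -> R, is_copula Ct /\
    forall u v : R, u \in `[0, 1] -> v \in `[0, 1] ->
      C u v = M * u * v + (1 - M) * Ct u v in
  (cond1 <-> cond2) /\ (cond2 <-> cond3).
Proof.
move=> cond1 cond2 cond3.
have [[mu [mu01 mu1 mu2 muC]] C_of] := C_copula.
have mu_marg : uniform_marginals mu by split.
have marg1 (A : set R) : measurable A ->
    distribution P (pair_RV X1 X2) (A `*` setT) = distribution P X1 A.
  by move=> mA; congr (P _); apply/seteqP; split => t // -[].
have marg2 (A : set R) : measurable A ->
    distribution P (pair_RV X1 X2) (setT `*` A) = distribution P X2 A.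
  by move=> mA; congr (P _); apply/seteqP; split => t // -[].
have PX_null (A B : set R) : measurable A -> measurable B ->
    (@lebesgue_measure R A * @lebesgue_measure R B = 0)%E ->
    distribution P (pair_RV X1 X2) (A `*` B) = 0%E.
  move=> mA mB AB0; have mAB : measurable (A `*` B) by exact: measurableX.
  have leb_null :
      (@lebesgue_measure R \x @lebesgue_measure R)%E.-null_set (A `*` B).
    apply/measure0_null_setP; first exact: measurableX.
    by apply: etrans AB0; exact: product_measure1E.
  by move/nu_abs_cont/PX_abs_cont : leb_null; apply.
have noatom1 x : distribution P X1 [set x] = 0%E.
  by rewrite -marg1// PX_null// lebesgue_measure_set1 mul0e.
have noatom2 x : distribution P X2 [set x] = 0%E.
  by rewrite -marg2// PX_null// lebesgue_measure_set1 mule0.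
have cond1P := le_density_product marg1 marg2 nu_prod PX_abs_cont (ltW M_gt0).
have transport := le_copula_product mu_marg muC C_of noatom1 noatom2 M.
have mu_dominated : mu `<< (@unif01 R \x @unif01 R)%E.
  apply: (copula_dominates mu_marg muC C_of noatom1 noatom2).
  exact: dominates_product marg1 marg2 nu_prod PX_abs_cont.
have ge_of_2 : cond2 ->
    forall B, measurable B -> (M%:E * (@unif01 R \x @unif01 R) B <= mu B)%E.
  move=> c2.
  exact: copula_density_measure_ge mu_dominated muC (ltW M_gt0) c2.
have ge_3 := mixture_copula M_lt1 mu01 mu_marg muC.
have c3_2 : cond3 -> cond2.
  move=> [Ct [Ct_copula CE]] u v c; apply: copula_density_lower_bound.
  move=> u1 u2 v1 v2 u1I u2I v1I v2I u12 v12; rewrite !CE//.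
  have := copula_rectangle Ct_copula u1I u2I v1I v2I u12 v12.
  nra.
split; split.
- by move=> /cond1P/transport/ge_3/c3_2.
- by move=> /ge_of_2/transport/cond1P.
- by move=> /ge_of_2/ge_3.
- exact: c3_2.
Qed.
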